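(* Let $f_1,f_2:\mathbb{R}^{n_x}\to\mathbb{R}^{n_f}$ be the two feed-forward neural networks described in the context, let $\mathcal{X}\subseteq\mathbb{R}^{n_x}\times\mathbb{R}^{n_x}$ be the set of admissible input pairs $(x_1,x_2)$, and let $P_{\mathcal{X}}(\cdot)$, $P_q(\cdot)$, $\Lambda(\cdot)$ be symmetric-matrix-valued functions of multiplier variables ranging over given admissible sets, such that the networks satisfy the quadratic constraints $$\eta^TP_{\mathcal{X}}\eta\ge 0,\qquad \eta^TP_q\,\eta\ge 0,\qquad \mu^T\Lambda\mu=\eta^T(E^T\Lambda E)\eta\ge 0\qquad\text{for all }(x_1,x_2)\in\mathcal{X}$$ for every admissible value of the multipliers, where $\mu=\mu(x_1,x_2)$, $\eta=\eta(x_1,x_2)$ and $E$ are as defined in the context. Let $w_{x_1},w_{x_2},w_x,w_{\mathrm{aff}}\ge 0$ be real weights. Suppose there exists a solution (values of $\gamma_{x_1},\gamma_{x_2},\gamma_x,\gamma\in\mathbb{R}$ and admissible values of the multipliers) to the semidefinite programme $$\begin{aligned}\min\quad & w_{x_1}\gamma_{x_1}+w_{x_2}\gamma_{x_2}+w_x\gamma_x+w_{\mathrm{aff}}\gamma\\ \text{subject to}\quad & P_{\mathcal{X}}(\cdot)+P_q(\cdot)+E^T\Lambda(\cdot)E+V^T\Gamma(\gamma_{x_1},\gamma_{x_2},\gamma_x,\gamma)V\prec 0,\\ & \gamma_{x_1}\ge 0,\ \gamma_{x_2}\ge 0,\ \gamma_x\ge 0,\ \gamma\ge 0,\end{aligned}$$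 with $V$ and $\Gamma$ as defined in the context. Then for this solution $$\|f_1(x_1)-f_2(x_2)\|_2^2\le \gamma+\gamma_{x_1}\|x_1\|_2^2+\gamma_{x_2}\|x_2\|_2^2+\gamma_x\|x_1-x_2\|_2^2\qquad\text{for all }(x_1,x_2)\in\mathcal{X}.$$
   Context: Networks. Fix $\ell\ge 1$ hidden layers of widths $n_1,\dots,n_\ell$, put $n_0=n_x$ and $M=\sum_{k=1}^{\ell}n_k$. Let $\phi:\mathbb{R}\to\mathbb{R}$ be an activation function, applied elementwise to vectors. For $i\in\{1,2\}$, network $i$ has weights $W_i^k\in\mathbb{R}^{n_{k+1}\times n_k}$ and biases $b_i^k\in\mathbb{R}^{n_{k+1}}$ for $k=0,\dots,\ell-1$, and output parameters $W_i^\ell\in\mathbb{R}^{n_f\times n_\ell}$, $b_i^\ell\in\mathbb{R}^{n_f}$, and is defined by $$x_i^0=x_i,\qquad x_i^{k+1}=\phi(W_i^kx_i^k+b_i^k)\ (k=0,\dots,\ell-1),\qquad f_i(x_i)=W_i^\ell x_i^\ell+b_i^\ell.$$ Compact notation. Put $\xi_i^{k+1}=W_i^kx_i^k+b_i^k$ for $k=0,\dots,\ell-1$, and let $\xi_i=(\xi_i^1,\dots,\xi_i^\ell)\in\mathbb{R}^M$ be the stacked vector of activation arguments, so that $\phi(\xi_i)=(x_i^1,\dots,x_i^\ell)$. For $(x_1,x_2)$ define $$\mu=\begin{bmatrix}\xi_1^T&\xi_2^T&\phi(\xi_1)^T&\phi(\xi_2)^T&1\end{bmatrix}^T\in\mathbb{R}^{4M+1},\qquad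 \eta=\begin{bmatrix}x_1^T&x_2^T&\phi(\xi_1)^T&\phi(\xi_2)^T&1\end{bmatrix}^T\in\mathbb{R}^{2(n_x+M)+1}.$$ Since each $\xi_i$ is an affine function of $x_i$ and $\phi(\xi_i)$ (namely $\xi_i^1=W_i^0x_i+b_i^0$, and $\xi_i^{k+1}=W_i^k\phi(\xi_i^k)+b_i^k$ for $k\ge1$), these formulas define a matrix $E\in\mathbb{R}^{(4M+1)\times(2(n_x+M)+1)}$, depending only on the weights and biases, with $\mu=E\eta$. Quadratic constraint matrices. $P_{\mathcal{X}}$ and $P_q$ are symmetric of size $2(n_x+M)+1$, and $\Lambda$ is symmetric of size $4M+1$; partitioned conformally with $\mu$, its $(1,1),(1,2),(2,1),(2,2)$ blocks are zero. They encode, respectively, information about the input set $\mathcal{X}$, about the input quantisation function (taken as $P_q=0$ when no input quantisation is considered), and about the activation function $\phi$. The set $\mathcal{X}$ may encode relations between the two inputs (for example $x_2$ being the quantised version of $x_1$). Error matrices. With blocks partitioned by sizes $(n_x,n_x,n_f,n_f,1)$, $$\Gamma(\gamma_{x_1},\gamma_{x_2},\gamma_x,\gamma)=\begin{bmatrix}-(\gamma_{x_1}+\gamma_x)I&\gamma_xI&0&0&0\\ \gamma_xI&-(\gamma_{x_2}+\gamma_x)I&0&0&0\\0&0&I&-I&0\\0&0&-I&I&0\\0&0&0&0&-\gamma\end{bmatrix},$$ and, with columns partitioned by sizes $(n_x,n_x,M,M,1)$, $$V=\begin{bmatrix}I&0&0&0&0\\0&I&0&0&0\\0&0&[\,0\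 \ W_1^\ell\,]&0&b_1^\ell\\0&0&0&[\,0\ \ W_2^\ell\,]&b_2^\ell\\0&0&0&0&1\end{bmatrix},$$ where $[\,0\ \ W_i^\ell\,]\in\mathbb{R}^{n_f\times M}$ has its zero block of size $n_f\times(M-n_\ell)$. Thus $V\eta=(x_1,x_2,f_1(x_1),f_2(x_2),1)$. The notation $A\prec 0$ means that the symmetric matrix $A$ is negative definite. *)

(* Defs.v *)
From HB Require Import structures.
From mathcomp Require Import all_boot all_order all_algebra.
From mathcomp Require Import classical_sets reals.

Set Implicit Arguments.
Unset Strict Implicit.
Unset Printing Implicit Defensive.

Import Order.TTheory GRing.Theory Num.Theory.

Local Open Scope ring_scope.

Definition col5 (T : Type) (m1 m2 m3 m4 m5 n : nat)
    (A1 : 'M[T]_(m1, n)) (A2 : 'M[T]_(m2, n)) (A3 : 'M[T]_(m3, n))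
    (A4 : 'M[T]_(m4, n)) (A5 : 'M[T]_(m5, n)) :
    'M[T]_(m1 + (m2 + (m3 + (m4 + m5))), n) :=
  col_mx A1 (col_mx A2 (col_mx A3 (col_mx A4 A5))).

Definition row5 (T : Type) (m n1 n2 n3 n4 n5 : nat)
    (A1 : 'M[T]_(m, n1)) (A2 : 'M[T]_(m, n2)) (A3 : 'M[T]_(m, n3))
    (A4 : 'M[T]_(m, n4)) (A5 : 'M[T]_(m, n5)) :
    'M[T]_(m, n1 + (n2 + (n3 + (n4 + n5)))) :=
  row_mx A1 (row_mx A2 (row_mx A3 (row_mx A4 A5))).

Definition norm2 (R : realType) (m : nat) (x : 'cV[R]_m) : R :=
  Num.sqrt (\sum_(i < m) x i ord0 ^+ 2).

Definition qform (R : realType) (m : nat) (P : 'M[R]_m) (v : 'cV[R]_m) : R :=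
  (v^T *m P *m v) ord0 ord0.

Definition negdef (R : realType) (m : nat) (A : 'M[R]_m) : Prop :=
  A \is symmetricmx /\ forall v : 'cV[R]_m, v != 0 -> qform A v < 0.

(* The widths are [n 0] (the input dimension n_x) and [n 1], ..., [n l]; the
   values [n k] for [k > l], and the weights and biases for [k >= l], are
   never used. *)
Record network (R : realType) (nf l : nat) (n : nat -> nat) := Network {
  weight : forall k : nat, 'M[R]_(n k.+1, n k);
  bias : forall k : nat, 'cV[R]_(n k.+1);
  out_weight : 'M[R]_(nf, n l);
  out_bias : 'cV[R]_nf }.

Notation hidden_dim l n := (\sum_(k < l) n k.+1)%N.
Notation mu_dim l n :=
  (hidden_dim l n + (hidden_dim l n +
    (hidden_dim l n + (hidden_dim l n + 1))))%N.
Notation eta_dim l n :=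
  (n 0%N + (n 0%N + (hidden_dim l n + (hidden_dim l n + 1))))%N.

Section Networks.
Context {R : realType} {nf l : nat} {n : nat -> nat}.
Implicit Types (phi : R -> R) (N : network R nf l n) (x : 'cV[R]_(n 0%N)).

Fixpoint layer phi N x (k : nat) : 'cV[R]_(n k) :=
  match k with
  | 0%N => x
  | k'.+1 => map_mx phi (weight N k' *m layer phi N x k' + bias N k')
  end.

Definition net_eval phi N x : 'cV[R]_nf :=
  out_weight N *m layer phi N x l + out_bias N.

Definition preact phi N x : 'cV[R]_(hidden_dim l n) :=
  \mxcol_(k < l) (weight N k *m layer phi N x k + bias N k).

Definition mu_vec phi N1 N2 x1 x2 : 'cV[R]_(mu_dim l n) :=
  col5 (preact phi N1 x1) (preact phi N2 x2)
       (map_mx phi (preact phi N1 x1)) (map_mx phi (preact phi N2 x2)) 1%:M.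

Definition eta_vec phi N1 N2 x1 x2 : 'cV[R]_(eta_dim l n) :=
  col5 x1 x2
       (map_mx phi (preact phi N1 x1)) (map_mx phi (preact phi N2 x2)) 1%:M.

(* [xi = in_mx *m x + rec_mx *m phi(xi) + bias_mx]: block row [i] of [in_mx]
   is W^0 for [i = 0] and zero otherwise, and block (i, j) of [rec_mx] is W^i
   for [i = j + 1] and zero otherwise.  In the selected cases the dimensions
   agree, so that [conform_mx] is a mere cast. *)
Definition in_mx N : 'M[R]_(hidden_dim l n, n 0%N) :=
  \mxcol_(i < l) (if i == 0%N :> nat then conform_mx 0 (weight N i) else 0).

Definition rec_mx N : 'M[R]_(hidden_dim l n, hidden_dim l n) :=
  \mxblock_(i < l, j < l)
    (if i == j.+1 :> nat then conform_mx 0 (weight N i) else 0).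

Definition bias_mx N : 'cV[R]_(hidden_dim l n) := \mxcol_(i < l) bias N i.

Definition E_mx N1 N2 : 'M[R]_(mu_dim l n, eta_dim l n) :=
  col5 (row5 (in_mx N1) 0          (rec_mx N1) 0           (bias_mx N1))
       (row5 0          (in_mx N2) 0           (rec_mx N2) (bias_mx N2))
       (row5 0          0          1%:M        0           0)
       (row5 0          0          0           1%:M        0)
       (row5 0          0          0           0           1%:M).

(* The matrix [0 W^l]: only the last block, of width [n l], is nonzero. *)
Definition last_mx N : 'M[R]_(nf, hidden_dim l n) :=
  \mxrow_(j < l) (if j.+1 == l then conform_mx 0 (out_weight N) else 0).

Definition V_mx N1 N2 :
    'M[R]_(n 0%N + (n 0%N + (nf + (nf + 1))), eta_dim l n) :=
  col5 (row5 1%:M 0    0            0            0)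
       (row5 0    1%:M 0            0            0)
       (row5 0    0    (last_mx N1) 0            (out_bias N1))
       (row5 0    0    0            (last_mx N2) (out_bias N2))
       (row5 0    0    0            0            1%:M).

End Networks.

Definition Gamma_mx {R : realType} (nx nf : nat) (gx1 gx2 gx g : R) :
    'M[R]_(nx + (nx + (nf + (nf + 1)))) :=
  col5 (row5 (- (gx1 + gx))%:M gx%:M               0         0         0)
       (row5 gx%:M             (- (gx2 + gx))%:M   0         0         0)
       (row5 0                 0                   1%:M      (- 1%:M)  0)
       (row5 0                 0                   (- 1%:M)  1%:M      0)
       (row5 0                 0                   0         0         (- g)%:M).

(* The blocks (1,1), (1,2), (2,1) and (2,2) of [L] in the partition of [mu_vec]
   vanish. *)
Definition zero_preact_blocks {R : realType} {l : nat} {n : nat -> nat}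
    (L : 'M[R]_(mu_dim l n)) : Prop :=
  [/\ ulsubmx L = 0, lsubmx (ursubmx L) = 0,
      usubmx (dlsubmx L) = 0 & ulsubmx (drsubmx L) = 0].

Record sdp_point (R : realType) (TX Tq TL : Type) := SdpPoint {
  gamma_x1 : R;
  gamma_x2 : R;
  gamma_x : R;
  gamma : R;
  mult_X : TX;
  mult_q : Tq;
  mult_L : TL }.

Section SDP.
Context {R : realType} {nf l : nat} {n : nat -> nat} {TX Tq TL : Type}.
Variables (N1 N2 : network R nf l n).
Variables (AX : set TX) (Aq : set Tq) (AL : set TL).
Variables (PX : TX -> 'M[R]_(eta_dim l n)) (Pq : Tq -> 'M[R]_(eta_dim l n)).
Variables (Lam : TL -> 'M[R]_(mu_dim l n)).
Variables (wx1 wx2 wx waff : R).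
Implicit Types p q : sdp_point R TX Tq TL.

Definition sdp_objective p : R :=
  wx1 * gamma_x1 p + wx2 * gamma_x2 p + wx * gamma_x p + waff * gamma p.

Definition sdp_matrix p : 'M[R]_(eta_dim l n) :=
  PX (mult_X p) + Pq (mult_q p)
  + (E_mx N1 N2)^T *m Lam (mult_L p) *m E_mx N1 N2
  + (V_mx N1 N2)^T
      *m Gamma_mx (n 0%N) nf (gamma_x1 p) (gamma_x2 p) (gamma_x p) (gamma p)
      *m V_mx N1 N2.

Definition sdp_feasible p : Prop :=
  [/\ [/\ AX (mult_X p), Aq (mult_q p) & AL (mult_L p)],
      negdef (sdp_matrix p)
    & [/\ 0 <= gamma_x1 p, 0 <= gamma_x2 p, 0 <= gamma_x p & 0 <= gamma p]].

Definition sdp_optimal p : Prop :=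
  sdp_feasible p /\
  forall q, sdp_feasible q -> sdp_objective p <= sdp_objective q.

End SDP.

Definition error_bound {R : realType} {nf l : nat} {n : nat -> nat}
    {TX Tq TL : Type} (phi : R -> R) (N1 N2 : network R nf l n)
    (X : set ('cV[R]_(n 0%N) * 'cV[R]_(n 0%N))) (p : sdp_point R TX Tq TL) :
    Prop :=
  forall x1 x2 : 'cV[R]_(n 0%N), X (x1, x2) ->
    norm2 (net_eval phi N1 x1 - net_eval phi N2 x2) ^+ 2
      <= gamma p + gamma_x1 p * norm2 x1 ^+ 2 + gamma_x2 p * norm2 x2 ^+ 2
         + gamma_x p * norm2 (x1 - x2) ^+ 2.

(* Main.v *)
Require Import Defs.
From HB Require Import structures.
From mathcomp Require Import all_boot all_order all_algebra.
From mathcomp Require Import classical_sets reals.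
From mathcomp Require Import lra.

Set Implicit Arguments.
Unset Strict Implicit.
Unset Printing Implicit Defensive.

Import Order.TTheory GRing.Theory Num.Theory.

Local Open Scope ring_scope.

(* Since eta ends with the entry 1, it is nonzero, so evaluating the linear
   matrix inequality at eta gives a strict inequality.  The three quadratic
   constraints drop out of it, and the remaining term, the quadratic form of
   Gamma at V eta = (x1, x2, f1 x1, f2 x2, 1), is the difference of the two
   sides of the error bound. *)

Lemma mul_row5_col5 (R : pzSemiRingType) (m n1 n2 n3 n4 n5 p : nat)
    (A1 : 'M[R]_(m, n1)) (A2 : 'M[R]_(m, n2)) (A3 : 'M[R]_(m, n3))
    (A4 : 'M[R]_(m, n4)) (A5 : 'M[R]_(m, n5))
    (B1 : 'M[R]_(n1, p)) (B2 : 'M[R]_(n2, p)) (B3 : 'M[R]_(n3, p))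
    (B4 : 'M[R]_(n4, p)) (B5 : 'M[R]_(n5, p)) :
  row5 A1 A2 A3 A4 A5 *m col5 B1 B2 B3 B4 B5 =
  A1 *m B1 + A2 *m B2 + A3 *m B3 + A4 *m B4 + A5 *m B5.
Proof. by rewrite !mul_row_col !addrA. Qed.

Lemma mul_col5 (R : pzSemiRingType) (m1 m2 m3 m4 m5 n p : nat)
    (A1 : 'M[R]_(m1, n)) (A2 : 'M[R]_(m2, n)) (A3 : 'M[R]_(m3, n))
    (A4 : 'M[R]_(m4, n)) (A5 : 'M[R]_(m5, n)) (B : 'M[R]_(n, p)) :
  col5 A1 A2 A3 A4 A5 *m B =
  col5 (A1 *m B) (A2 *m B) (A3 *m B) (A4 *m B) (A5 *m B).
Proof. by rewrite /col5 !mul_col_mx. Qed.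

Lemma tr_col5 (T : Type) (m1 m2 m3 m4 m5 n : nat)
    (A1 : 'M[T]_(m1, n)) (A2 : 'M[T]_(m2, n)) (A3 : 'M[T]_(m3, n))
    (A4 : 'M[T]_(m4, n)) (A5 : 'M[T]_(m5, n)) :
  (col5 A1 A2 A3 A4 A5)^T = row5 A1^T A2^T A3^T A4^T A5^T.
Proof. by rewrite /col5 !tr_col_mx. Qed.

Lemma col5_neq0 (R : nzRingType) (m1 m2 m3 m4 n : nat)
    (A1 : 'M[R]_(m1, n.+1)) (A2 : 'M[R]_(m2, n.+1)) (A3 : 'M[R]_(m3, n.+1))
    (A4 : 'M[R]_(m4, n.+1)) : col5 A1 A2 A3 A4 1%:M != 0.
Proof.
by rewrite /col5 !col_mx_eq0 oner_eq0 !andbF.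
Qed.

Lemma map_mxcol (T U : Type) (f : T -> U) (p m : nat) (p_ : 'I_p -> nat)
    (C_ : forall i, 'M[T]_(p_ i, m)) :
  map_mx f (\mxcol_i C_ i) = \mxcol_i map_mx f (C_ i).
Proof. by apply/matrixP => i j; rewrite !mxE. Qed.

Lemma qformD (R : realType) (m : nat) (P Q : 'M[R]_m) (v : 'cV[R]_m) :
  qform (P + Q) v = qform P v + qform Q v.
Proof. by rewrite /qform mulmxDr mulmxDl mxE. Qed.

(** Moves a congruence factor onto the vector: with [E_mx] it turns the $\Lambda$ term at $\eta$
    into its form at $\mu$, and with [V_mx] it turns the $\Gamma$ term into a form at $V\eta$. *)
Lemma qform_congr (R : realType) (m k : nat) (A : 'M[R]_(m, k)) (P : 'M[R]_m)
    (v : 'cV[R]_k) : qform (A^T *m P *m A) v = qform P (A *m v).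
Proof. by rewrite /qform trmx_mul !mulmxA. Qed.

Lemma norm2_sqr (R : realType) (m : nat) (x : 'cV[R]_m) :
  norm2 x ^+ 2 = (x^T *m x) ord0 ord0.
Proof.
rewrite sqr_sqrtr; last by apply: sumr_ge0 => i _; exact: sqr_ge0.
by rewrite mxE; apply: eq_bigr => i _; rewrite mxE expr2.
Qed.

(** The cross terms $x^Ty$ and $y^Tx$ are kept apart, just as the two off-diagonal blocks of
    $\Gamma$ produce them. *)
Lemma norm2_sqrB (R : realType) (m : nat) (x y : 'cV[R]_m) :
  norm2 (x - y) ^+ 2 =
  (x^T *m x) ord0 ord0 - (x^T *m y) ord0 ord0
  - ((y^T *m x) ord0 ord0 - (y^T *m y) ord0 ord0).
Proof.
rewrite norm2_sqr (linearB (@trmx R m 1)) mulmxBl !mulmxBr.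
move: (x^T *m x) (x^T *m y) (y^T *m x) (y^T *m y) => a b c d.
by rewrite !mxE.
Qed.

Lemma qform_Gamma (R : realType) (nx nf : nat) (gx1 gx2 gx g : R)
    (x1 x2 : 'cV[R]_nx) (y1 y2 : 'cV[R]_nf) :
  qform (Gamma_mx nx nf gx1 gx2 gx g) (col5 x1 x2 y1 y2 1%:M) =
  norm2 (y1 - y2) ^+ 2
  - (g + gx1 * norm2 x1 ^+ 2 + gx2 * norm2 x2 ^+ 2 + gx * norm2 (x1 - x2) ^+ 2).
Proof.
rewrite /qform -mulmxA mul_col5 !mul_row5_col5 !mul0mx !mul_scalar_mx !mulNmx.
rewrite !mul1mx !addr0 !add0r tr_col5 mul_row5_col5 trmx1 mul1mx.
rewrite !norm2_sqrB !norm2_sqr !mulmxDr !mulmxN -!scalemxAr.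
(* The products are generalised so that [mxE] exposes their entries as atoms instead of unfolding
   them into sums. *)
move: (x1^T *m x1) (x1^T *m x2) (x2^T *m x1) (x2^T *m x2) => a b c d.
move: (y1^T *m y1) (y1^T *m y2) (y2^T *m y1) (y2^T *m y2) => p q r s.
rewrite !mxE /=.
lra.
Qed.

Section Networks.
Context {R : realType} {nf l : nat} {n : nat -> nat}.
Variables (phi : R -> R) (N : network R nf l n) (x : 'cV[R]_(n 0%N)).

Lemma map_preact :
  map_mx phi (preact phi N x) = \mxcol_(k < l) layer phi N x k.+1.
Proof. exact: map_mxcol. Qed.

(** Block $j$ of $\phi(\xi)$ is layer $j+1$, so block row $i+1$ of [rec_mx] picks layer $i+1$ from
    block $i$, while block row 0 receives the input through [in_mx]. *)
Lemma preactE :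
  preact phi N x =
  in_mx N *m x + rec_mx N *m map_mx phi (preact phi N x) + bias_mx N.
Proof.
rewrite map_preact mxcol_mul mul_mxblock_mxrow -!mxcolD.
(* Splitting on the bare number [i] makes the dimensions agree by computation, so that
   [conform_mx_id] applies. *)
apply: eq_mxcol => -[i ltil] /=; congr (_ + _); case: i ltil => [|i] ltil /=.
  by rewrite conform_mx_id big1 ?addr0 // => j _; rewrite mul0mx.
rewrite mul0mx add0r (bigD1 (Ordinal (ltnW ltil))) //= eqxx conform_mx_id.
rewrite big1 ?addr0 // => j neqj.
rewrite ifN ?mul0mx //; apply: contra neqj => /eqP[eqij].
by apply/eqP/val_inj.
Qed.

(** The last block of $\phi(\xi)$, at index [l.-1], is layer [l]; [l_gt0] ensures that this block
    exists. *)
Lemma net_evalE (l_gt0 : (0 < l)%N) :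
  net_eval phi N x =
  last_mx N *m map_mx phi (preact phi N x) + out_bias N.
Proof.
rewrite map_preact mul_mxrow_mxcol; congr (_ + _).
have ltl : (l.-1 < l)%N by rewrite prednK.
rewrite (bigD1 (Ordinal ltl)) // big1 => [|j neqj]; last first.
  rewrite ifN ?mul0mx //; apply: contra neqj => /eqP eqjl.
  by apply/eqP/val_inj/(congr1 predn eqjl).
(* Here [prednK] also rewrites the block width [n l.-1.+1] to [n l], after which the cast is the
   identity. *)
by rewrite [RHS]addr0 ifT prednK ?conform_mx_id.
Qed.

End Networks.

Lemma E_mx_eta (R : realType) (nf l : nat) (n : nat -> nat) (phi : R -> R)
    (N1 N2 : network R nf l n) (x1 x2 : 'cV[R]_(n 0%N)) :
  E_mx N1 N2 *m eta_vec phi N1 N2 x1 x2 = mu_vec phi N1 N2 x1 x2.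
Proof.
rewrite mul_col5 !mul_row5_col5 !mul0mx !mul1mx !mulmx1 !addr0 !add0r.
by rewrite -!preactE.
Qed.

Lemma V_mx_eta (R : realType) (nf l : nat) (n : nat -> nat) (l_gt0 : (0 < l)%N)
    (phi : R -> R) (N1 N2 : network R nf l n) (x1 x2 : 'cV[R]_(n 0%N)) :
  V_mx N1 N2 *m eta_vec phi N1 N2 x1 x2 =
  col5 x1 x2 (net_eval phi N1 x1) (net_eval phi N2 x2) 1%:M.
Proof.
rewrite mul_col5 !mul_row5_col5 !mul0mx !mul1mx !mulmx1 !addr0 !add0r.
by rewrite -!net_evalE.
Qed.

Theorem theorem1 (R : realType) (l nf : nat) (n : nat -> nat)
    (hl : (1 <= l)%N) (phi : R -> R) (N1 N2 : network R nf l n)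
    (X : set ('cV[R]_(n 0%N) * 'cV[R]_(n 0%N)))
    (TX Tq TL : Type) (AX : set TX) (Aq : set Tq) (AL : set TL)
    (PX : TX -> 'M[R]_(eta_dim l n)) (Pq : Tq -> 'M[R]_(eta_dim l n))
    (Lam : TL -> 'M[R]_(mu_dim l n))
    (PX_sym : forall t, AX t -> PX t \is symmetricmx)
    (Pq_sym : forall t, Aq t -> Pq t \is symmetricmx)
    (Lam_sym : forall t, AL t -> Lam t \is symmetricmx)
    (Lam_blocks : forall t, AL t -> zero_preact_blocks (Lam t))
    (PX_qc : forall t, AX t -> forall x1 x2, X (x1, x2) ->
      0 <= qform (PX t) (eta_vec phi N1 N2 x1 x2))
    (Pq_qc : forall t, Aq t -> forall x1 x2, X (x1, x2) ->
      0 <= qform (Pq t) (eta_vec phi N1 N2 x1 x2))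
    (Lam_qc : forall t, AL t -> forall x1 x2, X (x1, x2) ->
      0 <= qform (Lam t) (mu_vec phi N1 N2 x1 x2))
    (wx1 wx2 wx waff : R)
    (hwx1 : 0 <= wx1) (hwx2 : 0 <= wx2) (hwx : 0 <= wx) (hwaff : 0 <= waff) :
  (forall p : sdp_point R TX Tq TL,
     sdp_feasible N1 N2 AX Aq AL PX Pq Lam p -> error_bound phi N1 N2 X p) /\
  (forall p : sdp_point R TX Tq TL,
     sdp_optimal N1 N2 AX Aq AL PX Pq Lam wx1 wx2 wx waff p ->
     error_bound phi N1 N2 X p).
Proof.
(* An optimal point is feasible, so both parts reduce to this claim. *)
have feasible_bound (p : sdp_point R TX Tq TL) :
    sdp_feasible N1 N2 AX Aq AL PX Pq Lam p -> error_bound phi N1 N2 X p.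
  case=> -[hX hq hL] [_ /(_ _ (col5_neq0 _ _ _ _)) neg] _ x1 x2 hx.
  (* The first four blocks of the test vector were left free; these choices make it $\eta$. *)
  have := neg x1 x2 (map_mx phi (preact phi N1 x1))
                    (map_mx phi (preact phi N2 x2)).
  rewrite -/(eta_vec phi N1 N2 x1 x2) !qformD !qform_congr E_mx_eta.
  rewrite V_mx_eta // qform_Gamma.
  have := PX_qc _ hX _ _ hx; have := Pq_qc _ hq _ _ hx.
  have := Lam_qc _ hL _ _ hx; lra.
by split=> p; [|case=> feas _]; apply: feasible_bound.
Qed.
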